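(* Let $\alpha_1,\alpha_2\in\mathbb{N}$ with $|\alpha_1-\alpha_2|\le1$, let $m$ be an integer with $1\le m\le\min\{\alpha_1,\alpha_2\}$, and let $\underline{e}\in\mathbb{R}^2$ be a unit vector. Then the system $$\alpha_1\frac{p_i-\underline{e}}{|p_i-\underline{e}|^2}+\alpha_2\frac{p_i+\underline{e}}{|p_i+\underline{e}|^2}=2\sum_{j\neq i}\frac{p_i-p_j}{|p_i-p_j|^2},\qquad 1\le i\le m,$$ for pairwise distinct points $p_1,\dots,p_m\in\mathbb{R}^2\setminus\{\underline{e},-\underline{e}\}$, is uniquely solvable: there is exactly one set $\{p_1,\dots,p_m\}$ of solutions (i.e. the solution is unique up to relabeling the points).
   Context: $\mathbb{N}=\{1,2,3,\dots\}$. $|\cdot|$ is the Euclidean norm on $\mathbb{R}^2$. *)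

(* Defs.v *)
From HB Require Import structures.
From mathcomp Require Import all_boot all_order all_algebra.
From mathcomp Require Import classical_sets functions reals.

Set Implicit Arguments.
Unset Strict Implicit.
Unset Printing Implicit Defensive.

Import Order.TTheory GRing.Theory Num.Theory.
Local Open Scope ring_scope.

(* The library norm `|v| on row vectors is the sup norm, so the Euclidean norm
   has to be defined here. *)
Definition enorm (R : realType) (n : nat) (v : 'rV[R]_n) : R :=
  Num.sqrt (\sum_(k < n) v 0 k ^+ 2).

(* v / |v|^2; only meaningful for v <> 0 (its value at 0 is 0). *)
Definition inversion (R : realType) (n : nat) (v : 'rV[R]_n) : 'rV[R]_n :=
  (enorm v ^+ 2)^-1 *: v.

(* The requirements on p besides the equations keep all the arguments of
   inversion away from 0. *)
Definition is_solution (R : realType) (a1 a2 m : nat) (e : 'rV[R]_2)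
    (p : 'I_m -> 'rV[R]_2) : Prop :=
  [/\ injective p,
      forall i, p i <> e /\ p i <> - e
    & forall i, a1%:R *: inversion (p i - e) + a2%:R *: inversion (p i + e)
                = 2 *: \sum_(j < m | j != i) inversion (p i - p j)].

(* Main.v *)
Require Import Defs.
From mathcomp Require Import all_boot all_order all_algebra.
From mathcomp Require Import classical_sets functions reals.
From mathcomp Require Import separable complex ring zify.

(** In the conjugate complex coordinate z the equations read
    a1 / (z_i - u) + a2 / (z_i + u) = 2 \sum_(j != i) 1 / (z_i - z_j).
    Following Stieltjes, for P = \prod_j (X - z_j) the right-hand side is
    P''(z_i) / P'(z_i), so the system says that
    (X^2 - u^2) P'' - (a1 (X + u) + a2 (X - u)) P' vanishes at all roots of P;
    as it has degree at most m, it is l P, where l is read off the leading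
    coefficient.  This differential operator is triangular in the monomial
    basis, and for m <= min(a1, a2) its m-th diagonal entry l differs from the
    earlier ones, so there is exactly one monic eigenpolynomial of degree m.
    Comparing lowest-order terms at a root shows that its roots are simple and
    different from u and -u. *)

Set Implicit Arguments.
Unset Strict Implicit.
Unset Printing Implicit Defensive.

Import Order.TTheory GRing.Theory Num.Theory.
Local Open Scope ring_scope.

(** * The differential operator and its eigenpolynomials *)

Section HeineStieltjesOperator.
Variable F : fieldType.
Implicit Types (u l x : F) (P Q G : {poly F}) (m : nat).

Definition hs_op u (b1 b2 : F) l P : {poly F} :=
  ('X^2 - (u ^+ 2)%:P) * P^`()^`()
  - (b1%:P * ('X + u%:P) + b2%:P * ('X - u%:P)) * P^`() - l%:P * P.

Lemma hs_op_swap u b1 b2 l P : hs_op (- u) b2 b1 l P = hs_op u b1 b2 l P.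
Proof. by rewrite /hs_op polyCN; ring. Qed.

Lemma hs_opB u b1 b2 l P Q :
  hs_op u b1 b2 l (P - Q) = hs_op u b1 b2 l P - hs_op u b1 b2 l Q.
Proof. by rewrite /hs_op !derivB; ring. Qed.

Lemma hs_opCM u b1 b2 l (c : F) P :
  hs_op u b1 b2 l (c%:P * P) = c%:P * hs_op u b1 b2 l P.
Proof. by rewrite /hs_op !mul_polyC !derivZ -!mul_polyC; ring. Qed.

(** The diagonal entry at ['X^k] of the operator [hs_op u b1 b2 0] in the monomial basis. *)
Definition hs_eig (b1 b2 : F) (k : nat) : F :=
  k%:R * (k%:R - 1) - (b1 + b2) * k%:R.

Lemma coef_hs_op u b1 b2 l P k :
  (hs_op u b1 b2 l P)`_k = (hs_eig b1 b2 k - l) * P`_k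
    - u ^+ 2 * (k.+1%:R * k.+2%:R) * P`_k.+2
    - (b1 - b2) * u * k.+1%:R * P`_k.+1.
Proof.
have -> : hs_op u b1 b2 l P = 'X^2 * P^`()^`() - (u ^+ 2)%:P * P^`()^`()
    - (b1 + b2)%:P * ('X * P^`()) - ((b1 - b2) * u)%:P * P^`() - l%:P * P.
  by rewrite /hs_op !(polyCD, polyCN, polyCM); ring.
rewrite !coefB !coefCM coefXnM coefXM !coef_deriv /hs_eig.
(* Multiplication by ['X^2] and ['X] shifts indices, so the indices 0 and 1 are boundary cases. *)
case: k => [|[|k]] /=; rewrite ?coef_deriv ?subSS ?subn0; ring.
Qed.

Lemma hs_eigB b1 b2 (k m : nat) :
  hs_eig b1 b2 k - hs_eig b1 b2 m
  = (k%:R - m%:R) * (k%:R + m%:R - 1 - b1 - b2).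
Proof. by rewrite /hs_eig; ring. Qed.

Lemma size_hs_op u b1 b2 l P n :
  (size P <= n)%N -> (size (hs_op u b1 b2 l P) <= n)%N.
Proof.
move=> /leq_sizeP Pn; apply/leq_sizeP => j nj.
by rewrite coef_hs_op !Pn ?mulr0 ?subr0 // ltnW // ltnW.
Qed.

(** The diagonal entry at index n is [hs_eig b1 b2 n - l], so this choice of [l] kills the top
    coefficient. *)
Lemma size_hs_op_eig u b1 b2 P n : (size P <= n.+1)%N ->
  (size (hs_op u b1 b2 (hs_eig b1 b2 n) P) <= n)%N.
Proof.
move=> /leq_sizeP Pn; apply/leq_sizeP => j nj.
rewrite coef_hs_op !(Pn j.+1) ?(Pn j.+2) ?mulr0 ?subr0 //; last exact: ltnW.
move: nj; rewrite leq_eqVlt => /orP[/eqP <-|nj]; first by rewrite subrr mul0r.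
by rewrite Pn ?mulr0.
Qed.

(** If P were nonzero of degree d < m, coefficient d of its image would be [lead_coef P] times the
    nonzero [hs_eig b1 b2 d - hs_eig b1 b2 m]. *)
Lemma hs_op_inj u b1 b2 m P :
    (forall k, (k < m)%N -> hs_eig b1 b2 k != hs_eig b1 b2 m) ->
  (size P <= m)%N -> hs_op u b1 b2 (hs_eig b1 b2 m) P = 0 -> P = 0.
Proof.
move=> eig_neq Pm LP0; apply/eqP; apply: contraT => Pn0.
have sP : (0 < size P)%N by rewrite size_poly_gt0.
have := congr1 (fun q : {poly F} => q`_(size P).-1) LP0.
rewrite coef_hs_op coef0 !prednK // [P`_(size P)]nth_default //.
rewrite [P`__.+1]nth_default // !mulr0 !subr0 -lead_coefE.
move/eqP; rewrite mulf_eq0 subr_eq0 lead_coef_eq0 (negPf Pn0) orbF.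
by rewrite (negPf (eig_neq _ _)) // prednK.
Qed.

Lemma hs_op_exists u b1 b2 m :
    (forall k, (k < m)%N -> hs_eig b1 b2 k != hs_eig b1 b2 m) ->
  exists P, [/\ P \is monic, size P = m.+1
              & hs_op u b1 b2 (hs_eig b1 b2 m) P = 0].
Proof.
move=> eig_neq; set L := hs_op _ _ _ _.
(* Start from X^m and remove the coefficients of L P from the top down. *)
suff H k : (k <= m)%N -> exists P,
    [/\ P \is monic, size P = m.+1 & (size (L P) <= m - k)%N].
  have [P [Pm sP]] := H _ (leqnn m).
  by rewrite subnn size_poly_leq0 => /eqP LP; exists P.
elim: k => [_|k IH km].
  exists 'X^m; rewrite monicXn size_polyXn subn0; split=> //.
  by apply: size_hs_op_eig; rewrite size_polyXn.
have [P [Pm sP LP]] := IH (ltnW km).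
pose j := (m - k.+1)%N.
have jm : (j < m)%N by rewrite /j; lia.
have jk : (m - k = j.+1)%N by rewrite /j; lia.
(* Coefficient j of [L 'X^j] is the denominator, so subtracting [c%:P * 'X^j] cancels coefficient j
   of [L P]; the higher coefficients stay 0. *)
pose c := (L P)`_j / (hs_eig b1 b2 j - hs_eig b1 b2 m).
have sQ : (size (c%:P * 'X^j)%R < size P)%N.
  rewrite mul_polyC (leq_ltn_trans (size_scale_leq _ _)) //.
  by rewrite size_polyXn sP ltnS.
exists (P - c%:P * 'X^j); split.
- by rewrite monicE lead_coefDl ?size_polyN // -monicE.
- by rewrite size_polyDl ?size_polyN.
rewrite /L hs_opB hs_opCM -/L; apply/leq_sizeP => i; rewrite -/j leq_eqVlt.
rewrite coefB coefCM => /orP[/eqP <-|ji].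
  rewrite (coef_hs_op _ _ _ _ 'X^j) !coefXn eqxx !gtn_eqF // !mulr0 !subr0 mulr1 /c.
  by rewrite divfK ?subrr // subr_eq0 eig_neq.
have /leq_sizeP -> // : (size (L P) <= i)%N.
  by rewrite (leq_trans LP) // jk.
have /leq_sizeP -> // : (size (L 'X^j) <= i)%N.
  by rewrite (leq_trans _ ji) // size_hs_op // size_polyXn.
by rewrite mulr0 subr0.
Qed.

(** * Indicial equations at a root of multiplicity r *)

Lemma deriv_mul_expXsubC x G r :
  ('X - x%:P) * (G * ('X - x%:P) ^+ r)^`()
  = (r%:R * G + ('X - x%:P) * G^`()) * ('X - x%:P) ^+ r.
Proof.
rewrite derivM deriv_exp derivXsubC mul1r -mulr_natr.
by case: r => [|r]; rewrite /= ?exprS; ring.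
Qed.

Lemma deriv2_mul_expXsubC x G r :
  ('X - x%:P) ^+ 2 * (G * ('X - x%:P) ^+ r)^`()^`()
  = ((r%:R * (r%:R - 1)) * G + ('X - x%:P) *
      (2 * r%:R * G^`() + ('X - x%:P) * G^`()^`())) * ('X - x%:P) ^+ r.
Proof.
set P := G * _; set t := 'X - x%:P.
have tP := deriv_mul_expXsubC x G r; rewrite -/t -/P in tP.
have dtP : (t * P^`())^`() = P^`() + t * P^`()^`().
  by rewrite derivM /t derivXsubC mul1r.
(* Since t P' is again a cofactor times t^r, the first-order rule applies to it too; then t^2 P'' =
   t (t P')' - t P'. *)
have := deriv_mul_expXsubC x (r%:R * G + t * G^`()) r.
rewrite -/t -tP dtP mulrDr tP => E.
have -> : t ^+ 2 * P^`()^`() = t * (t * P^`()^`()) by ring.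
apply: (addrI ((r%:R * G + t * G^`()) * t ^+ r)); rewrite E.
rewrite -polyC_natr !derivE; ring.
Qed.

(** After multiplication by (X - x)^2 the power (X - x)^r splits off, and at x only the
    second-derivative term of the cofactor survives. *)
Lemma hs_op_root_simple u b1 b2 l x G r :
    hs_op u b1 b2 l (G * ('X - x%:P) ^+ r) = 0 ->
  (x ^+ 2 - u ^+ 2) * (r%:R * (r%:R - 1)) * G.[x] = 0.
Proof.
set t := 'X - x%:P; set P := G * _ => LP0.
have /eqP : t ^+ 2 * hs_op u b1 b2 l P = 0 by rewrite LP0 mulr0.
rewrite (_ : _ * _ = ('X^2 - (u ^+ 2)%:P) * (t ^+ 2 * P^`()^`())
    - (b1%:P * ('X + u%:P) + b2%:P * ('X - u%:P)) * t * (t * P^`())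
    - l%:P * P * t ^+ 2); last by rewrite /hs_op; ring.
rewrite deriv2_mul_expXsubC deriv_mul_expXsubC -/t.
set A := r%:R * (_ - 1) * G + _; set B := r%:R * G + _.
rewrite (_ : _ - _ - _ = (('X^2 - (u ^+ 2)%:P) * A
    - (b1%:P * ('X + u%:P) + b2%:P * ('X - u%:P)) * t * B
    - l%:P * G * t ^+ 2) * t ^+ r); last by rewrite /P -/t; ring.
rewrite mulf_eq0 expf_eq0 polyXsubC_eq0 andbF orbF => /eqP/(congr1 (horner^~ x)).
rewrite /A /B /t !hornerE subrr => <-.
by rewrite -!polyC_natr !hornerE /=; ring.
Qed.

(** As X^2 - u^2 vanishes at u, one factor X - u suffices here, and both derivative terms contribute
    at lowest order: r (r - 1) from the second, - b1 r from the first. *)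
Lemma hs_op_root_pole u b1 b2 l G r :
    hs_op u b1 b2 l (G * ('X - u%:P) ^+ r) = 0 ->
  2 * u * r%:R * (r%:R - 1 - b1) * G.[u] = 0.
Proof.
set t := 'X - u%:P; set P := G * _ => LP0.
have /eqP : t * hs_op u b1 b2 l P = 0 by rewrite LP0 mulr0.
rewrite (_ : _ * _ = ('X + u%:P) * (t ^+ 2 * P^`()^`())
    - (b1%:P * ('X + u%:P) + b2%:P * t) * (t * P^`())
    - l%:P * P * t); last by rewrite /hs_op /t polyC_exp; ring.
rewrite deriv2_mul_expXsubC deriv_mul_expXsubC -/t.
set A := r%:R * (_ - 1) * G + _; set B := r%:R * G + _.
rewrite (_ : _ - _ - _ = (('X + u%:P) * A
    - (b1%:P * ('X + u%:P) + b2%:P * t) * B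
    - l%:P * G * t) * t ^+ r); last by rewrite /P -/t; ring.
rewrite mulf_eq0 expf_eq0 polyXsubC_eq0 andbF orbF => /eqP/(congr1 (horner^~ u)).
rewrite /A /B /t !hornerE subrr => <-.
by rewrite -!polyC_natr !hornerE /=; ring.
Qed.

(** * Equilibrium equations as a differential equation *)

Lemma deriv_prod_XsubC_logderiv (I : finType) (A : pred I) (z : I -> F) x :
    (forall j, A j -> x != z j) ->
  (\prod_(j | A j) ('X - (z j)%:P))^`().[x]
  = (\prod_(j | A j) ('X - (z j)%:P)).[x] * \sum_(j | A j) (x - z j)^-1.
Proof.
move=> xz.
pose K (p : {poly F}) (s : F) := p^`().[x] = p.[x] * s.
apply: (big_rec2 K); first by rewrite /K derivC mulr0 horner0.
move=> j s p Aj; rewrite /K derivM derivXsubC !hornerE => ->.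
by field; rewrite subr_eq0 xz.
Qed.

(** Writing P = (X - z_i) Q gives P'(z_i) = Q(z_i) and P''(z_i) = 2 Q'(z_i); the sum is the
    logarithmic derivative of Q. *)
Lemma deriv2_prod_XsubC m (z : 'I_m -> F) i : injective z ->
  let P := \prod_j ('X - (z j)%:P) in
  P^`().[z i] != 0 /\
  P^`()^`().[z i] = 2 * P^`().[z i] * \sum_(j | j != i) (z i - z j)^-1.
Proof.
move=> zI P; pose Q := \prod_(j | j != i) ('X - (z j)%:P).
have zij j : j != i -> z i != z j by rewrite (inj_eq zI) eq_sym.
have PE : P = ('X - (z i)%:P) * Q by rewrite /P (bigD1 i).
have P1 : P^`().[z i] = Q.[z i].
  by rewrite PE derivM derivXsubC !hornerE subrr; ring.
have P2 : P^`()^`().[z i] = 2 * Q^`().[z i].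
  rewrite PE derivM derivXsubC mul1r derivD derivM derivXsubC.
  by rewrite !hornerE subrr /=; ring.
split; last by rewrite P2 P1 deriv_prod_XsubC_logderiv // mulrA.
rewrite P1 horner_prod; apply/prodf_neq0 => j /zij ij.
by rewrite !hornerE subr_eq0.
Qed.

Definition equilibrium u (b1 b2 : F) m (z : 'I_m -> F) := forall i,
  b1 / (z i - u) + b2 / (z i + u) = 2 * \sum_(j | j != i) (z i - z j)^-1.

(** The value of the image at z_i is a nonzero factor times the defect of the i-th equation.
    Conversely, an image of degree below m with m distinct roots is 0. *)
Lemma hs_op_prod_XsubC_eq0 u b1 b2 m (z : 'I_m -> F) :
    injective z -> (forall i, z i != u /\ z i != - u) ->
  hs_op u b1 b2 (hs_eig b1 b2 m) (\prod_j ('X - (z j)%:P)) = 0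
  <-> equilibrium u b1 b2 z.
Proof.
move=> zI zu; set P := \prod_j _; set L := hs_op _ _ _ _ _.
have rP i : P.[z i] = 0.
  by rewrite /P (bigD1 i) //= hornerM hornerXsubC subrr mul0r.
have LE i : L.[z i] = P^`().[z i] * (z i - u) * (z i + u) *
    (2 * (\sum_(j | j != i) (z i - z j)^-1)
     - (b1 / (z i - u) + b2 / (z i + u))).
  rewrite /L /hs_op !hornerE rP (deriv2_prod_XsubC i zI).2.
  have [/eqP zu1 /eqP zu2] := zu i.
  by field; rewrite !(subr_eq0, addr_eq0); apply/andP; split; apply/eqP.
split=> [L0 i|eqz].
  have := LE i; rewrite L0 horner0 => /esym/eqP; rewrite !mulf_eq0.
  have [zu1 zu2] := zu i.
  rewrite (negPf (deriv2_prod_XsubC i zI).1) subr_eq0 (negPf zu1).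
  by rewrite addr_eq0 (negPf zu2) subr_eq0 /= => /eqP.
apply: (@roots_geq_poly_eq0 _ _ [seq z i | i <- enum 'I_m]).
- by apply/allP => _ /mapP[i _ ->]; rewrite /root LE eqz subrr mulr0.
- by rewrite map_inj_uniq ?enum_uniq.
rewrite size_map size_enum_ord; apply: size_hs_op_eig.
by rewrite size_prod_XsubC /index_enum -enumT size_enum_ord.
Qed.

End HeineStieltjesOperator.

(** * Uniqueness and existence of complex equilibria *)

Lemma hs_eig_neq (F : numFieldType) (a1 a2 m k : nat) :
    (m <= a1)%N -> (m <= a2)%N -> (k < m)%N ->
  hs_eig (a1%:R : F) a2%:R k != hs_eig a1%:R a2%:R m.
Proof.
move=> m1 m2 km; rewrite -subr_eq0 hs_eigB mulf_neq0 //.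
  by rewrite subr_eq0 eqr_nat neq_ltn km.
(* This factor is negative: k + m < 2 m <= a1 + a2. *)
rewrite (_ : _ - _ = (k + m)%:R - (1 + a1 + a2)%:R); last by ring.
by rewrite subr_eq0 eqr_nat; lia.
Qed.

(** Both products are monic of degree m with image 0, so their difference has degree below m and
    [hs_op_inj] applies. *)
Lemma equilibrium_uniq (F : numFieldType) (u : F) (a1 a2 m : nat)
    (z w : 'I_m -> F) :
    (m <= a1)%N -> (m <= a2)%N ->
    injective z -> (forall i, z i != u /\ z i != - u) ->
    injective w -> (forall i, w i != u /\ w i != - u) ->
    equilibrium u a1%:R a2%:R z -> equilibrium u a1%:R a2%:R w ->
  \prod_j ('X - (z j)%:P) = \prod_j ('X - (w j)%:P).
Proof.
move=> m1 m2 zI zu wI wu.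
move/(hs_op_prod_XsubC_eq0 _ _ zI zu) => Lz.
move/(hs_op_prod_XsubC_eq0 _ _ wI wu) => Lw.
apply: subr0_eq.
apply: (hs_op_inj (u := u) (fun k => @hs_eig_neq F a1 a2 m k m1 m2)).
  have sP (y : 'I_m -> F) : size (\prod_j ('X - (y j)%:P)) = m.+1.
    by rewrite size_prod_XsubC /index_enum -enumT size_enum_ord.
  have cP (y : 'I_m -> F) : (\prod_j ('X - (y j)%:P))`_m = 1.
    by have /monicP := monic_prod_XsubC (index_enum 'I_m) predT y;
      rewrite lead_coefE sP.
  apply/leq_sizeP => j; rewrite leq_eqVlt => /orP[/eqP <-|mj].
    by rewrite coefB !cP subrr.
  by rewrite coefB !nth_default ?subrr ?sP.
by rewrite hs_opB Lz Lw subrr.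
Qed.

Lemma hs_op_eq0_roots (F : numFieldType) (u : F) (a1 a2 : nat) (l : F)
    (P : {poly F}) (x : F) :
    u != 0 -> P != 0 -> (size P <= a1.+1)%N -> (size P <= a2.+1)%N ->
    hs_op u a1%:R a2%:R l P = 0 -> root P x ->
  [/\ x != u, x != - u & P^`().[x] != 0].
Proof.
move=> u0 P0 sP1 sP2 LP Px.
have [r [G]] := multiplicity_XsubC P x; rewrite P0 /= => Gx PE.
have r_gt0 : (0 < r)%N.
  by case: r PE => // PE; rewrite PE expr0 mulr1 (negPf Gx) in Px.
have G0 : G != 0 by apply: contraNneq P0 => G0; rewrite PE G0 mul0r.
(* Hence r is at most a1 and a2, which rules out the indicial roots a1 + 1 at u and a2 + 1 at -
   u. *)
have sP : (r < size P)%N.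
  rewrite PE size_Mmonic ?monicXn ?monic_exp ?monicXsubC // size_exp_XsubC.
  by rewrite addnS /= -[X in (X < _)%N]add0n ltn_add2r size_poly_gt0.
have r0 : r%:R != 0 :> F by rewrite pnatr_eq0 -lt0n.
(* By hs_op_swap, the pole -u is the pole u with a1 and a2 exchanged. *)
have no_pole (v : F) (c d : nat) : v != 0 -> (r <= c)%N ->
    hs_op v c%:R d%:R l P = 0 -> x != v.
  move=> v0 rc; rewrite PE => LPv; apply/eqP => xv; rewrite xv in LPv Gx.
  have /eqP := hs_op_root_pole LPv.
  rewrite !mulf_eq0 pnatr_eq0 /= (negPf v0) (negPf r0) -/(root G v) (negPf Gx) orbF /=.
  by rewrite -addrA -opprD subr_eq0 -[1](mulr1n 1) -natrD eqr_nat; lia.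
have xu : x != u by apply: (no_pole u a1 a2) => //; lia.
have xNu : x != - u.
  by apply: (no_pole (- u) a2 a1); rewrite ?oppr_eq0 ?hs_op_swap //; lia.
split=> //.
have r1 : r = 1%N.
  have /eqP := hs_op_root_simple (etrans (congr1 _ (esym PE)) LP).
  rewrite subr_sqr !mulf_eq0 !subr_eq0 addr_eq0 (negPf xu) (negPf xNu).
  by rewrite (negPf r0) -(mulr1n 1) eqr_nat -/(root G x) (negPf Gx) orbF => /eqP.
by rewrite PE r1 expr1 derivM derivXsubC !hornerE subrr mulr0 add0r.
Qed.

Lemma equilibrium_exists (F : numClosedFieldType) (u : F) (a1 a2 m : nat) :
    (m <= a1)%N -> (m <= a2)%N -> u != 0 ->
  exists z : 'I_m -> F, [/\ injective z, forall i, z i != u /\ z i != - u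
    & equilibrium u a1%:R a2%:R z].
Proof.
move=> m1 m2 u0.
have [P [Pm sP LP]] := hs_op_exists u (fun k => @hs_eig_neq F a1 a2 m k m1 m2).
have Pn0 := monic_neq0 Pm.
have rootP x : root P x -> [/\ x != u, x != - u & P^`().[x] != 0].
  by apply: hs_op_eq0_roots LP => //; rewrite sP ltnS.
have [rs] := closed_field_poly_normal P.
rewrite (monicP Pm) scale1r => PE.
(* Over a closed field, coprimality of P and P' is checked at the roots of P, where P' is
   nonzero. *)
have rs_uniq : uniq rs.
  rewrite -separable_prod_XsubC -PE.
  by rewrite unlock; apply/Pdiv.ClosedField.coprimepP => x /rootP[].
have rs_size : size rs = m by move: sP; rewrite PE size_prod_XsubC => -[].
pose z (i : 'I_m) := rs`_i.
have zI : injective z.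
  by move=> i j /eqP; rewrite nth_uniq ?rs_size // => /eqP/val_inj.
have zu i : z i != u /\ z i != - u.
  have /rootP[] // : root P (z i).
  by rewrite PE root_prod_XsubC mem_nth // rs_size.
exists z; split=> //; apply/(hs_op_prod_XsubC_eq0 _ _ zI zu).
by rewrite -LP PE (big_nth 0) rs_size big_mkord.
Qed.

(** * The planar system in complex coordinates *)

(* Points of the plane are encoded as the conjugates of their complex
   coordinates; inversion then becomes z |-> 1 / z up to conjugation. *)
Section ConjugateCoordinate.
Variable R : rcfType.
Implicit Types (v : 'rV[R]_2) (z : R[i]).

Definition conjcoord v : R[i] := Complex (v 0 0) (- v 0 1).
Definition conjcoord_inv z : 'rV[R]_2 :=
  \row_k (if k == 0 then complex.Re z else - complex.Im z).

Lemma conjcoordK : cancel conjcoord conjcoord_inv.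
Proof.
move=> v; apply/rowP => k; rewrite !mxE /=; case: eqP => [->//|/eqP k0].
by rewrite opprK; congr (v 0 _); apply/val_inj; case: k k0 => -[|[|[]]].
Qed.

Lemma conjcoord_invK : cancel conjcoord_inv conjcoord.
Proof. by case=> x y; rewrite /conjcoord !mxE /= opprK. Qed.

Lemma conjcoordD v w : conjcoord (v + w) = conjcoord v + conjcoord w.
Proof. by rewrite /conjcoord !mxE opprD. Qed.

Lemma conjcoordN v : conjcoord (- v) = - conjcoord v.
Proof. by rewrite /conjcoord !mxE. Qed.

Lemma conjcoordB v w : conjcoord (v - w) = conjcoord v - conjcoord w.
Proof. by rewrite conjcoordD conjcoordN. Qed.

Lemma conjcoordMn v n : conjcoord (v *+ n) = conjcoord v *+ n.
Proof.
elim: n => [|n IH]; last by rewrite !mulrS conjcoordD IH.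
by rewrite !mulr0n /conjcoord !mxE oppr0.
Qed.

Lemma conjcoord_sum (I : finType) (A : pred I) (v : I -> 'rV[R]_2) :
  conjcoord (\sum_(i | A i) v i) = \sum_(i | A i) conjcoord (v i).
Proof.
by apply: (big_morph _ conjcoordD); rewrite -[0](mulr0n 0) conjcoordMn mulr0n.
Qed.
End ConjugateCoordinate.

(** For complex w, w / |w|^2 is the conjugate of 1 / w; at 0 both are 0 by convention. *)
Lemma conjcoord_inversion (R : realType) (v : 'rV[R]_2) :
  conjcoord (inversion v) = ((conjcoord v)^-1)^*%C.
Proof.
rewrite /inversion /enorm sqr_sqrtr ?sumr_ge0 // => [|k _]; last exact: sqr_ge0.
rewrite big_ord_recl big_ord1 (_ : lift _ _ = 1); last exact/val_inj.
rewrite /conjcoord !mxE; apply/eqP; rewrite eq_complex /= sqrrN.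
by rewrite -mulrN opprK ![_ * _^-1]mulrC !eqxx.
Qed.

Lemma is_solutionP (R : realType) (a1 a2 m : nat) (e : 'rV[R]_2)
    (p : 'I_m -> 'rV[R]_2) :
  let z := @conjcoord R \o p in let u := conjcoord e in
  is_solution a1 a2 e p <->
  [/\ injective z, forall i, z i != u /\ z i != - u
    & equilibrium u a1%:R a2%:R z].
Proof.
move=> z u; have cI := can_inj (@conjcoordK R).
have conjI : injective (fun x : R[i] => x^*%C) by exact: can_inj (@conjcK R).
have conjE (x y : R[i]) : x^*%C = y^*%C <-> x = y.
  by split=> [/conjI|->].
(* [conjcoord] sends each planar side to the conjugate of the complex side, and both maps are
   injective. *)
have eqnE i : a1%:R *: inversion (p i - e) + a2%:R *: inversion (p i + e)
      = 2 *: \sum_(j < m | j != i) inversion (p i - p j)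
    <-> a1%:R / (z i - u) + a2%:R / (z i + u)
      = 2 * \sum_(j | j != i) (z i - z j)^-1.
  rewrite -conjE.
  have <- : conjcoord (a1%:R *: inversion (p i - e)
      + a2%:R *: inversion (p i + e))
    = ((a1%:R / (z i - u) + a2%:R / (z i + u)))^*%C.
    rewrite !scaler_nat conjcoordD !conjcoordMn !conjcoord_inversion.
    by rewrite conjcoordB conjcoordD rmorphD !rmorphM !rmorph_nat !mulr_natl.
  have <- : conjcoord (2 *: \sum_(j < m | j != i) inversion (p i - p j))
    = (2 * \sum_(j | j != i) (z i - z j)^-1)^*%C.
    rewrite scaler_nat conjcoordMn conjcoord_sum rmorphM rmorph_nat mulr_natl.
    congr (_ *+ _); rewrite rmorph_sum; apply: eq_bigr => j _.
    by rewrite conjcoord_inversion conjcoordB.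
  by split=> [->//|/cI].
have coordNe v w : v <> w <-> conjcoord v != conjcoord w :> R[i].
  by split=> [vw|/eqP vw]; [apply/eqP => /cI | move=> E; apply: vw; rewrite E].
split=> -[pI pe eqn]; split.
- exact: inj_comp.
- move=> i; have [/coordNe pe1 /coordNe pe2] := pe i.
  by rewrite -conjcoordN.
- by move=> i; apply/eqnE/eqn.
- exact: inj_compr pI.
- by move=> i; have [pe1 pe2] := pe i; split; apply/coordNe; rewrite ?conjcoordN.
- by move=> i; apply/eqnE/eqn.
Qed.

(** * Existence and uniqueness of the solution set *)

Unset Implicit Arguments.
Set Strict Implicit.
Set Printing Implicit Defensive.

Theorem mainTheorem5 (R : realType) (a1 a2 m : nat) (e : 'rV[R]_2)
    (a1_gt0 : (0 < a1)%N) (a2_gt0 : (0 < a2)%N)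
    (a12 : `|a1%:Z - a2%:Z| <= 1)
    (m_gt0 : (1 <= m)%N) (m_le : (m <= minn a1 a2)%N)
    (e_unit : enorm e = 1) :
  exists! S : set 'rV[R]_2,
    exists p : 'I_m -> 'rV[R]_2, is_solution a1 a2 e p /\ S = range p.
Proof.
have [m1 m2] : (m <= a1)%N /\ (m <= a2)%N by apply/andP; rewrite -leq_min.
have u0 : conjcoord e != 0.
  apply: contra_eq_neq e_unit => /eqP; rewrite eq_complex /= oppr_eq0.
  move=> /andP[/eqP e0 /eqP e1]; rewrite /enorm big_ord_recl big_ord1.
  rewrite (_ : lift _ _ = 1); last exact/val_inj.
  by rewrite e0 e1 expr0n addr0 sqrtr0 eq_sym oner_eq0.
(* The unlabelled set is recovered from the polynomial, so equal polynomials give equal sets. *)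
have rangeE (p : 'I_m -> 'rV[R]_2) : range p
    = [set v | root (\prod_j ('X - (conjcoord (p j))%:P)) (conjcoord v)]%classic.
  apply/seteqP; split=> [_ [i _ <-]|v] /=.
    by rewrite /root (bigD1 i) //= hornerM hornerXsubC subrr mul0r.
  rewrite /root horner_prod => /prodf_eq0[i _].
  rewrite hornerXsubC subr_eq0 => /eqP/(can_inj (@conjcoordK R)) ->.
  by exists i.
have [z [zI zu eqz]] := equilibrium_exists m1 m2 u0.
pose p := @conjcoord_inv R \o z.
have zE : @conjcoord R \o p = z.
  by apply/boolp.funext => i; rewrite /p /= conjcoord_invK.
have p_sol : is_solution a1 a2 e p by apply/is_solutionP; rewrite zE.
exists (range p); split; first by exists p.
move=> _ [q [/is_solutionP[qI qu eqq] ->]].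
rewrite !rangeE; move/is_solutionP: p_sol => [pI pu eqp].
by rewrite (equilibrium_uniq m1 m2 pI pu qI qu eqp eqq).
Qed.
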